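(* Let $X=C[0,1]$ and let $h:\mathbb{R}\to\mathbb{R}$ be a $C^\infty$ bump function. Then the map $H:X\to X$ defined by $$H(x)(t)=h(x(t))\,x(t),\qquad x\in X,\ t\in[0,1],$$ is a $C^\infty$-blid map for $X$ with bounded derivatives of all orders, i.e. $\sup_{x\in X}\|D^jH(x)\|<\infty$ for every $j\ge 1$.
   Context: $C[0,1]$ is the Banach space of real-valued continuous functions on $[0,1]$ with norm $\|x\|=\max_{t\in[0,1]}|x(t)|$. A $C^\infty$ bump function on the real line is a $C^\infty$ function $h:\mathbb{R}\to\mathbb{R}$ with bounded support that is identically $1$ in a neighborhood of $0$. A $C^q$-blid map for a Banach space $X$ (with $q\in\mathbb{N}\cup\{\infty\}$) is a $C^q$ map $H:X\to X$ such that $H(x)=x$ for all $x$ in some neighborhood of $0$ and $\sup_{x\in X}\|H(x)\|<\infty$. Derivatives are Fréchet derivatives, and $\|D^jH(x)\|$ is the norm of the $j$-th derivative as a bounded $j$-linear map. *)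

(* Defs.v *)
From HB Require Import structures.
From mathcomp Require Import all_boot all_order all_algebra.
From mathcomp Require Import lra.
From mathcomp Require Import all_classical all_reals all_analysis.

Set Implicit Arguments.
Unset Strict Implicit.
Unset Printing Implicit Defensive.

Import Order.TTheory GRing.Theory Num.Theory.
Import numFieldNormedType.Exports.

Local Open Scope classical_set_scope.
Local Open Scope ring_scope.

Notation I01 R := (set_type (`[0, 1]%classic : set R)).

Record C01 (R : realType) := MkC01 {
  C01_fun :> I01 R -> R;
  C01_continuous : continuous C01_fun }.
Arguments C01_continuous {R} x : rename.
HB.instance Definition _ (R : realType) := gen_eqMixin (C01 R).
HB.instance Definition _ (R : realType) := gen_choiceMixin (C01 R).

Section C01_normed.
Variable R : realType.
Implicit Types x y z : C01 R.

Lemma C01P x y : (forall t, x t = y t) -> x = y.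
Proof.
case: x y => [f cf] [g cg] /= /funext fg; rewrite fg in cf *.
by congr MkC01; exact: Prop_irrelevance.
Qed.

Let cst0 := MkC01 (fun t => @cst_continuous (I01 R) R 0 t).
Let addc_subproof x y : continuous (fun t => x t + y t).
Proof. by move=> t; exact: (cvgD (C01_continuous x t) (C01_continuous y t)). Qed.
Let oppc_subproof x : continuous (fun t => - x t).
Proof. by move=> t; exact: (cvgN (C01_continuous x t)). Qed.
Let scalec_subproof (a : R) x : continuous (fun t => a * x t).
Proof. by move=> t; exact: (cvgMl_tmp (C01_continuous x t)). Qed.

Let addc x y : C01 R := MkC01 (@addc_subproof x y).
Let oppc x : C01 R := MkC01 (@oppc_subproof x).
Let scalec (a : R) x : C01 R := MkC01 (@scalec_subproof a x).

Let addcA : associative addc.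
Proof. by move=> x y z; apply: C01P => t; rewrite /= addrA. Qed.
Let addcC : commutative addc.
Proof. by move=> x y; apply: C01P => t; rewrite /= addrC. Qed.
Let add0c : left_id cst0 addc.
Proof. by move=> x; apply: C01P => t; rewrite /= add0r. Qed.
Let addNc : left_inverse cst0 oppc addc.
Proof. by move=> x; apply: C01P => t; rewrite /= addNr. Qed.

HB.instance Definition _ := GRing.isZmodule.Build (C01 R) addcA addcC add0c addNc.

Let scalecA a b x : scalec a (scalec b x) = scalec (a * b) x.
Proof. by apply: C01P => t; rewrite /= mulrA. Qed.
Let scale1c : left_id 1 scalec.
Proof. by move=> x; apply: C01P => t; rewrite /= mul1r. Qed.
Let scalecDr : right_distributive scalec +%R.
Proof. by move=> a x y; apply: C01P => t; rewrite /= mulrDr. Qed.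
Let scalecDl x : {morph scalec^~ x : a b / a + b}.
Proof. by move=> a b; apply: C01P => t; rewrite /= mulrDl. Qed.

HB.instance Definition _ :=
  GRing.Zmodule_isLmodule.Build R (C01 R) scalecA scale1c scalecDr scalecDl.

Lemma C01_0E t : (0 : C01 R) t = 0. Proof. by []. Qed.
Lemma C01_addE x y t : (x + y) t = x t + y t. Proof. by []. Qed.
Lemma C01_oppE x t : (- x) t = - x t. Proof. by []. Qed.
Lemma C01_scaleE (a : R) x t : (a *: x) t = a * x t. Proof. by []. Qed.

(* The supremum is attained (C01_norm_max), so this is the maximum norm. *)
Definition C01_norm x : R := sup (range (fun t => `|x t|)).

Let t0 : I01 R.
Proof. by exists 0; rewrite inE /= in_itv /= lexx ler01. Qed.

Lemma C01_norm_max x :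
  exists2 t, C01_norm x = `|x t| & forall s, `|x s| <= `|x t|.
Proof.
pose g : I01 R -> R := fun t => `|x t|.
pose f : R -> R := 'valL_(0 : R) g.
have fE (t : I01 R) : f (set_val t) = `|x t|.
  rewrite -[LHS]/((f \o set_val) t) /f; exact: (congr1 (@^~ t) (valLK 0 g)).
have cf : {within `[0, 1]%classic, continuous f}.
  apply/subspace_valL_continuousP' => t.
  exact: (cvg_norm (C01_continuous x t)).
have [c c01 maxf] := EVT_max ler01 cf.
pose t : I01 R := exist _ c (mem_set c01).
have xt s : `|x s| <= `|x t|.
  by rewrite -!fE; apply: maxf; apply: (set_mem (valP s)).
exists t => //; apply/eqP; rewrite eq_le; apply/andP; split.
  by apply: ge_sup; [exists `|x t0|, t0 | move=> _ [s _ <-]].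
by apply: ub_le_sup; [exists `|x t| => _ [s _ <-] | exists t].
Qed.

Lemma C01_norm_ge x t : `|x t| <= C01_norm x.
Proof. by have [s ->] := C01_norm_max x. Qed.

Lemma C01_norm_le x (M : R) : (forall t, `|x t| <= M) -> C01_norm x <= M.
Proof. by have [s ->] := C01_norm_max x. Qed.

Let C01_ler_normD x y : C01_norm (x + y) <= C01_norm x + C01_norm y.
Proof.
apply: C01_norm_le => t; rewrite C01_addE (le_trans (ler_normD _ _))//.
by rewrite lerD// C01_norm_ge.
Qed.

Let C01_normrZ (a : R) x : C01_norm (a *: x) = `|a| * C01_norm x.
Proof.
apply/eqP; rewrite eq_le; apply/andP; split.
  by apply: C01_norm_le => t; rewrite C01_scaleE normrM ler_wpM2l// C01_norm_ge.
have [t -> _] := C01_norm_max x.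
by rewrite -normrM -C01_scaleE C01_norm_ge.
Qed.

Let C01_normr0_eq0 x : C01_norm x = 0 -> x = 0.
Proof.
move=> x0; apply: C01P => t; apply/eqP; rewrite C01_0E -normr_le0 -x0.
exact: C01_norm_ge.
Qed.

HB.instance Definition _ :=
  Lmodule_isNormed.Build R (C01 R) C01_ler_normD C01_normrZ C01_normr0_eq0.

Lemma C01_normE x : `|x| = sup (range (fun t => `|x t|)).
Proof. by []. Qed.

Let C01_complete (F : set_system (C01 R)) : ProperFilter F -> cauchy F -> cvg F.
Proof.
move=> FF /cauchyP Fc.
have FD (e : R) : 0 < e ->
    exists z : C01 R, F [set y : C01 R | forall t, `|z t - y t| < e].
  move=> e0; have [z Fz] := Fc _ e0; exists z; apply: filterS Fz => y zy t /=.
  rewrite -C01_oppE -C01_addE; apply: (le_lt_trans (C01_norm_ge _ _)).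
  by move: zy; rewrite -ball_normE.
have cvF t : cvg ((fun x : C01 R => x t) @ F).
  apply: R_complete; apply/cauchyP => e e0.
  have [z Fz] := FD _ e0; exists (z t) => /=.
  by apply: filterS Fz => y /(_ t); rewrite -ball_normE.
pose l t : R := lim ((fun x : C01 R => x t) @ F).
have Fl (e : R) : 0 < e -> F [set x : C01 R | forall t, `|l t - x t| <= e].
  move=> e0; have e30 : 0 < e / 3 by rewrite divr_gt0.
  have [z Fz] := FD _ e30; apply: filterS (Fz) => x zx t /=.
  have /cvgrPdist_lt /(_ _ e30) lF : (fun y : C01 R => y t) @ F --> l t by exact: cvF.
  have [w /= [/(_ t) zw lw]] := filter_ex (filterI Fz lF).
  have := zx t; move: zw lw; rewrite !ltr_norml => /andP[? ?] /andP[? ?] /andP[? ?].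
  rewrite ler_norml; apply/andP; split; lra.
have cl : continuous l.
  move=> t; apply/(cvgrPdist_le (FF := nbhs_filter t)) => e e0.
  have e30 : 0 < e / 3 by rewrite divr_gt0.
  have [x /= lx] := filter_ex (Fl _ e30).
  have /(cvgrPdist_le (FF := nbhs_filter t)) /(_ _ e30) := C01_continuous x t.
  move=> cx; apply: (@filterS _ _ (nbhs_filter t) _ _ _ cx) => s /=; move: (lx t) (lx s); rewrite !ler_norml.
  by move=> /andP[? ?] /andP[? ?] /andP[? ?]; apply/andP; split; lra.
apply/cvg_ex; exists (MkC01 cl); apply/cvgrPdist_le => e e0.
apply: filterS (Fl _ e0) => x lx; exact: C01_norm_le.
Qed.

HB.instance Definition _ := Uniform_isComplete.Build (C01 R) C01_complete.

End C01_normed.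

Section multilinear.
Variables (R : realType) (V W : normedModType R) (n : nat).
Implicit Types (f : ('I_n -> V) -> W) (v : 'I_n -> V).

Definition multilinear f := forall v (i : 'I_n),
  linear (fun x : V => f (fun j => if j == i then x else v j)).

Definition mbounded f :=
  exists M : R, forall v, `|f v| <= M * \prod_(i < n) `|v i|.

Definition bmultilinear : {pred ('I_n -> V) -> W} :=
  [pred f | `[< multilinear f /\ mbounded f >]].

Lemma bmultilinearP f : f \in bmultilinear <-> multilinear f /\ mbounded f.
Proof. by split => [/asboolP|/asboolP]. Qed.

Record mlin := Mlin { mlin_fun :> ('I_n -> V) -> W;
                      _ : mlin_fun \in bmultilinear }.
HB.instance Definition _ := [isSub for mlin_fun].
HB.instance Definition _ := [Choice of mlin by <:].

Let bmultilinear_submod : submod_closed bmultilinear.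
Proof.
split.
  apply/bmultilinearP; split => [v i a x y|].
    by rewrite /= scaler0 addr0.
  by exists 0 => v; rewrite normr0 mul0r.
move=> a f g /bmultilinearP[lf [M Mf]] /bmultilinearP[lg [N Ng]].
have fgE v : (a *: f + g) v = a *: f v + g v by [].
apply/bmultilinearP; split => [v i b x y|].
  by rewrite !fgE lf lg !scalerDr !scalerA (mulrC a b) addrACA.
exists (`|a| * M + N) => v; rewrite mulrDl -mulrA.
by rewrite (le_trans (ler_normD _ _))// lerD// normrZ ler_wpM2l.
Qed.

HB.instance Definition _ :=
  GRing.isSubmodClosed.Build R (('I_n -> V) -> W) bmultilinear bmultilinear_submod.
HB.instance Definition _ := [SubChoice_isSubLmodule of mlin by <:].

Implicit Types T S : mlin.

Lemma mlin_eqP T S : (forall v, T v = S v) -> T = S.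
Proof. by move=> TS; apply/val_inj/funext. Qed.

Lemma mlin_multilinear T : multilinear T.
Proof. by case: T => f /= /bmultilinearP[]. Qed.

Lemma mlin_bounded T : mbounded T.
Proof. by case: T => f /= /bmultilinearP[]. Qed.

Lemma mlin_0E v : (0 : mlin) v = 0. Proof. by []. Qed.
Lemma mlin_addE T S v : (T + S) v = T v + S v. Proof. by []. Qed.
Lemma mlin_scaleE (a : R) T v : (a *: T) v = a *: T v. Proof. by []. Qed.

Lemma mlin_scale_args T (c : 'I_n -> R) v :
  T (fun i => c i *: v i) = (\prod_i c i) *: T v.
Proof.
suff H (s : seq 'I_n) : uniq s ->
    T (fun j => if j \in s then c j *: v j else v j) = (\prod_(j <- s) c j) *: T v.
  rewrite -H ?index_enum_uniq//; congr (mlin_fun T _); apply/funext => j.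
  by rewrite mem_index_enum.
elim: s => [_|i s IH /= /andP[is_ us]].
  by rewrite big_nil scale1r.
rewrite big_cons -scalerA -IH//.
set w := fun j => if j \in s then c j *: v j else v j.
have := GRing.scalable_linear (mlin_multilinear T w i) (c i) (v i) => /=.
have -> : (fun j => if j == i then v i else w j) = w.
  by apply/funext => j; case: eqP => // ->; rewrite /w (negbTE is_).
move=> <-; congr (mlin_fun T _); apply/funext => j; rewrite in_cons /w.
by case: eqP => // ->.
Qed.

Definition mlin_norm T : R :=
  sup [set `|T v| | v in [set v | forall i, `|v i| <= 1]].

Lemma mlin_norm_ge1 T v : (forall i, `|v i| <= 1) -> `|T v| <= mlin_norm T.
Proof.
move=> v1; apply: ub_le_sup; last by exists v.
have [M TM] := mlin_bounded T; exists `|M| => _ [w w1 <-].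
rewrite (le_trans (TM w))// (le_trans (ler_wpM2r _ (ler_norm M)))//.
  by apply: prodr_ge0.
by rewrite ler_piMr//; apply: prodr_ile1 => i _; rewrite normr_ge0 w1.
Qed.

Lemma mlin_norm_le T (M : R) :
  (forall v, (forall i, `|v i| <= 1) -> `|T v| <= M) -> mlin_norm T <= M.
Proof.
move=> TM; apply: ge_sup => [|_ [v v1 <-]]; last exact: TM.
by exists `|T (fun=> 0)|, (fun=> 0) => // i; rewrite normr0.
Qed.

Lemma mlin_norm_bound T v : `|T v| <= mlin_norm T * \prod_(i < n) `|v i|.
Proof.
pose u i := `|v i|^-1 *: v i.
have u1 i : `|u i| <= 1.
  rewrite /u normrZ normfV normr_id.
  by have [->|v0] := eqVneq (`|v i|) 0; rewrite ?mulr0// mulVf.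
have {1}-> : v = (fun i => `|v i| *: u i).
  apply/funext => i; rewrite /u scalerA.
  have [->|v0] := eqVneq (v i) 0; first by rewrite scaler0.
  by rewrite divff ?scale1r// normr_eq0.
rewrite mlin_scale_args normrZ ger0_norm ?prodr_ge0// mulrC.
by rewrite ler_wpM2r ?prodr_ge0// mlin_norm_ge1.
Qed.

Let mlin_ler_normD T S : mlin_norm (T + S) <= mlin_norm T + mlin_norm S.
Proof.
apply: mlin_norm_le => v v1; rewrite mlin_addE (le_trans (ler_normD _ _))//.
by rewrite lerD// mlin_norm_ge1.
Qed.

Let mlin_normrZ (a : R) T : mlin_norm (a *: T) = `|a| * mlin_norm T.
Proof.
have le_ (b : R) S : mlin_norm (b *: S) <= `|b| * mlin_norm S.
  apply: mlin_norm_le => v v1.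
  by rewrite mlin_scaleE normrZ ler_wpM2l// mlin_norm_ge1.
apply/eqP; rewrite eq_le le_/=.
have [->|a0] := eqVneq a 0.
  rewrite normr0 mul0r (le_trans (normr_ge0 ((0 *: T) (fun=> 0))))//.
  by apply: mlin_norm_ge1 => i; rewrite normr0.
rewrite -ler_pdivlMl ?normr_gt0// -normfV.
by rewrite -{1}(scale1r T) -(mulVf a0) -scalerA le_.
Qed.

Let mlin_normr0_eq0 T : mlin_norm T = 0 -> T = 0.
Proof.
move=> T0; apply: mlin_eqP => v; apply/eqP; rewrite -normr_le0.
by rewrite (le_trans (mlin_norm_bound T v))// T0 mul0r.
Qed.

HB.instance Definition _ :=
  Lmodule_isNormed.Build R mlin mlin_ler_normD mlin_normrZ mlin_normr0_eq0.

Lemma mlin_normE T :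
  `|T| = sup [set `|T v| | v in [set v | forall i, `|v i| <= 1]].
Proof. by []. Qed.

(* f itself when f is bounded and n-linear, 0 otherwise. *)
Definition mlin_of f : mlin := insubd 0 f.

Lemma mlin_ofE f : multilinear f -> mbounded f -> mlin_of f = f :> (_ -> _).
Proof. by move=> lf bf; apply: insubdK; apply/bmultilinearP. Qed.

End multilinear.

Section frechet.
Variables (R : realType) (V W : normedModType R).
Implicit Type H : V -> W.

(* The n-th Frechet derivative as a bounded n-linear map:
   D^0 H(x) is H(x), seen as a 0-linear map, and
   D^{n+1} H(x)(v_0, ..., v_n) = D(D^n H)(x)(v_0)(v_1, ..., v_n).
   The value is meaningful when D^n H is differentiable at x, see fderivSE. *)
Fixpoint fderiv H (n : nat) : V -> mlin V W n :=
  match n with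
  | 0 => fun x => mlin_of (fun=> H x)
  | m.+1 => fun x => mlin_of (fun v : 'I_m.+1 -> V =>
      'd (fderiv H m) x (v ord0) (fun i => v (lift ord0 i)))
  end.

Lemma fderiv0E H x v : fderiv H 0 x v = H x.
Proof.
rewrite /= mlin_ofE//; first by move=> ? [].
by exists `|H x| => w; rewrite big_ord0 mulr1.
Qed.

Lemma fderivSE H n x v : differentiable (fderiv H n) x ->
  fderiv H n.+1 x v =
  'd (fderiv H n) x (v ord0) (fun i => v (lift ord0 i)).
Proof.
move=> dH; rewrite /= mlin_ofE//.
  move=> {}v i a y z /=; case: (unliftP ord0 i) => [k|] ->.
    rewrite (_ : (ord0 == lift ord0 k) = false)//.
    have E (w : V) : (fun j : 'I_n => if lift ord0 j == lift ord0 k then w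
        else v (lift ord0 j)) = fun j => if j == k then w else v (lift ord0 j).
      by apply/funext => j; rewrite (inj_eq (@lift_inj _ ord0)).
    by rewrite !E; exact: mlin_multilinear.
  by rewrite eqxx /= linearP.
have /linear_boundedP [k [_ dk]] : bounded_near ('d (fderiv H n) x) (nbhs (0 : V)).
  exact/continuous_linear_bounded/diff_continuous.
have /= k1 := dk (`|k| + 1) _.
exists (`|k| + 1) => w; rewrite big_ord_recl mulrA.
apply: (le_trans (mlin_norm_bound _ _)); apply: ler_wpM2r; first exact: prodr_ge0.
by apply: k1; rewrite (le_lt_trans (ler_norm k))// ltrDl.
Qed.

(* q = Some n stands for C^n and q = None for C^oo. *)
Definition class_C (q : option nat) H :=
  (forall j, (if q is Some n then (j < n)%N else true) ->
     forall x, differentiable (fderiv H j) x) /\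
  (forall j, (if q is Some n then (j <= n)%N else true) ->
     continuous (fderiv H j)).

End frechet.

Definition blid_map (R : realType) (X : completeNormedModType R)
    (q : option nat) (H : X -> X) :=
  [/\ class_C q H,
      \forall x \near (0 : X), H x = x &
      (ereal_sup (range (fun x => `|H x|%:E)) < +oo)%E].

(* h is C^oo when all its iterated derivatives are derivable. *)
Definition smooth_bump (R : realType) (h : R -> R) :=
  [/\ forall n s, derivable (h^`(n))%classic s 1,
      bounded_set (closure [set s | h s != 0]) &
      \forall s \near (0 : R), h s = 1].

(* Main.v *)
Require Import Defs.
From HB Require Import structures.
From mathcomp Require Import all_boot all_order all_algebra.
From mathcomp Require Import all_classical all_reals all_analysis.

Set Implicit Arguments.
Unset Strict Implicit.
Unset Printing Implicit Defensive.

Import Order.TTheory GRing.Theory Num.Theory.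
Import numFieldNormedType.Exports.

Local Open Scope classical_set_scope.
Local Open Scope ring_scope.

(* H is the superposition operator x |-> g o x of g s := h s * s, all of whose
   derivatives are bounded because g is smooth with compact support.  By
   Taylor's formula with a bounded second derivative, x |-> f o x is
   differentiable on C[0,1] with derivative y |-> (f' o x) y.  Composing with
   the linear contraction c |-> ((v_i)_i |-> c \prod_i v_i) gives by induction
     D^n H(x)(v_1, ..., v_n) = (g^(n) o x) v_1 ... v_n,
   whose norm is at most sup |g^(n)|. *)

Definition smooth (R : realType) (f : R -> R) :=
  forall n s, derivable (derive1n n f) s 1.

(** * Derivatives of smooth real functions *)

Section real_functions.
Variable R : realType.
Implicit Types f : R -> R.

Lemma smooth_continuous f n : smooth f -> continuous (derive1n n f).
Proof. by move=> sf s; apply/differentiable_continuous/derivable1_diffP. Qed.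

(** Leibniz rule: only two terms survive because the identity has zero second derivative. At [n = 0]
    the coefficient [n%:R] cancels the meaningless [n.-1]. *)
Lemma derive1n_mulid f n : smooth f ->
  derive1n n (fun s => f s * s) =
    fun s => derive1n n f s * s + n%:R * derive1n n.-1 f s.
Proof.
move=> sf; elim: n => [|n IHn]; apply/funext => s.
  by rewrite /= mul0r addr0.
have df m : is_derive s 1 (derive1n m f) (derive1n m.+1 f s).
  by apply: DeriveDef => //; rewrite derive1nS derive1E.
rewrite derive1nS IHn derive1E.
have dfn := df n; have dfp := df n.-1.
have d := is_deriveD (is_deriveM dfn (is_derive_id s 1))
  (is_deriveM (is_derive_cst (n%:R : R) s 1) dfp).
rewrite [LHS](@derive_val _ _ _ _ _ _ _ d) /= !scaler0 addr0.
rewrite -![_ *: _]/(_ * _) mulr1 [_ + s * _]addrC [s * _]mulrC -addrA.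
congr (_ + _).
(* For [n = 0] the derivative of order [n.-1.+1] is the first one, but its coefficient is 0. For a
   successor, [n.-1.+1] is [n] and the two multiples of the same derivative add up. *)
case: n {IHn dfn dfp d} => [|n] /=; first by rewrite mul0r addr0 mul1r.
by rewrite -[n.+2%:R]natr1 mulrDl mul1r addrC.
Qed.

Lemma smooth_mulid f : smooth f -> smooth (fun s => f s * s).
Proof.
move=> sf n s; rewrite derive1n_mulid//.
apply: derivableD; first by apply: derivableM => //; exact: derivable_id.
by apply: derivableM => //; exact: derivable_cst.
Qed.

(** Derivation is local: on the open set each derivative agrees near [s] with the constant 0. *)
Lemma derive1n_eq0_open f (U : set R) n s : open U ->
  (forall u, U u -> f u = 0) -> U s -> derive1n n f s = 0.
Proof.
move=> oU fU; elim: n s => [|n IHn] s Us; first exact: fU.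
rewrite derive1nS derive1E (@near_eq_derive _ _ _ _ (cst 0)) ?derive_cst//.
by apply: filterS (open_nbhs_nbhs (conj oU Us)) => u /IHn.
Qed.

(** The derivative is continuous, so bounded on a compact interval, and vanishes off the support. *)
Lemma smooth_derive1n_bounded f n : smooth f ->
    bounded_set (closure [set s | f s != 0]) ->
  exists M : R, forall s, `|derive1n n f s| <= M.
Proof.
move=> sf [K [_ Kf]].
(* [bounded_set] only gives bounds strictly above [K]; this one is also nonnegative, so that
   [[-L, L]] is an interval. *)
have K1 : K < `|K| + 1 by rewrite (le_lt_trans (ler_norm K))// ltrDl.
set L := `|K| + 1 in K1.
have L0 : 0 <= L by rewrite addr_ge0.
have cf : continuous (fun s => `|derive1n n f s|).
  by move=> s; apply: cvg_norm; exact: smooth_continuous.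
have [|c _ cmax] := @EVT_max R _ (- L) L _ (continuous_subspaceT cf).
  by rewrite (le_trans _ L0)// oppr_le0.
exists `|derive1n n f c| => s; have [sL|Ls] := lerP `|s| L.
  by apply: cmax; rewrite in_itv /= -ler_norml.
rewrite (@derive1n_eq0_open _ (~` closure [set s | f s != 0])) ?normr0//.
- exact/closed_openC/closed_closure.
- by move=> u /= nu; apply: contrapT => /eqP fu; apply/nu/subset_closure.
- by move=> /(Kf _ K1) /=; rewrite leNgt Ls.
Qed.

(** A form of the mean value theorem that covers both signs of [r]. *)
Lemma mean_value f s r : (forall u, derivable f u 1) ->
  exists2 c, `|c - s| <= `|r| & f (s + r) - f s = derive1 f c * r.
Proof.
move=> df.
have mvt a b : a <= b ->
    exists2 c, c \in `[a, b]%R & f b - f a = derive1 f c * (b - a).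
  move=> ab; apply: (@MVT_segment R) => // [u _|].
    by rewrite derive1E; apply: derivableP.
  by apply: derivable_within_continuous.
have [r0|/ltW r0] := lerP 0 r.
  have [|c + ->] := mvt s (s + r); first by rewrite lerDl.
  rewrite in_itv /= => /andP[sc cr]; exists c; last by rewrite (addrC s) addrK.
  by rewrite !ger0_norm// ?subr_ge0// lerBlDl.
have [|c + fE] := mvt (s + r) s; first by rewrite gerDl.
rewrite in_itv /= => /andP[rc cs]; exists c.
  by rewrite !ler0_norm// ?subr_le0// lerN2 lerBrDl.
by rewrite -opprB fE opprD addrA subrr add0r mulrN opprK.
Qed.

(** The mean value theorem is used twice: for [f], then for its derivative between [s] and the
    intermediate point [c], where [|c - s| <= |r|]. *)
Lemma taylor1_le f (M : R) s r : smooth f ->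
    (forall u, `|derive1n 2 f u| <= M) ->
  `|f (s + r) - f s - derive1 f s * r| <= M * `|r| ^+ 2.
Proof.
move=> sf fM.
have [c cs ->] := mean_value s r (sf 0%N).
have [d _ ] := mean_value s (c - s) (sf 1%N).
rewrite [s + _]addrC subrK => fE; rewrite -mulrBl fE.
rewrite !normrM expr2 mulrA ler_wpM2r//.
by apply: ler_pM => //; exact: fM.
Qed.

End real_functions.

(** * Multiplication by a fixed function, as a linear and as an n-linear map *)

Section C01_products.
Variable R : realType.
Implicit Types c x y : C01 R.

Let prod_subproof n c (v : 'I_n -> C01 R) :
  continuous (fun t => c t * \prod_(i < n) v i t).
Proof.
move=> t; apply: (cvgM (C01_continuous c t)).
by apply: cvg_big => [|i _]; [exact: mul_continuous | exact: (C01_continuous (v i) t)].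
Qed.

Definition C01_prod n c (v : 'I_n -> C01 R) : C01 R := MkC01 (@prod_subproof n c v).

Let mul_subproof c x : continuous (fun t => c t * x t).
Proof. by move=> t; exact: (cvgM (C01_continuous c t) (C01_continuous x t)). Qed.

Definition C01_mul c x : C01 R := MkC01 (@mul_subproof c x).

Lemma C01_prod_norm n c (v : 'I_n -> C01 R) :
  `|C01_prod c v| <= `|c| * \prod_(i < n) `|v i|.
Proof.
apply: C01_norm_le => t /=; rewrite normrM normr_prod ler_pM ?prodr_ge0//.
  exact: C01_norm_ge.
by apply: ler_prod => i _; rewrite normr_ge0; exact: C01_norm_ge.
Qed.

Lemma C01_mul_norm c x : `|C01_mul c x| <= `|c| * `|x|.
Proof.
by apply: C01_norm_le => t; rewrite normrM ler_pM//; exact: C01_norm_ge.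
Qed.

Lemma C01_mul_linear c : linear (C01_mul c).
Proof. by move=> a x y; apply: C01P => t /=; rewrite mulrDr mulrCA. Qed.

HB.instance Definition _ c :=
  GRing.isLinear.Build R (C01 R) (C01 R) _ (C01_mul c) (C01_mul_linear c).

Lemma C01_mul_continuous c : continuous (C01_mul c).
Proof.
apply: bounded_linear_continuous; apply/linear_boundedP.
exists `|c|; split => // r cr x.
by apply: (le_trans (C01_mul_norm c x)); rewrite ler_wpM2r// ltW.
Qed.

Let C01_prod_multilinear n c : multilinear (@C01_prod n c).
Proof.
move=> v i a x y; apply: C01P => t /=.
(* Isolating the [i]-th factor shows the dependence on it alone. *)
have E w : \prod_j (if j == i then w else v j) t =
    w t * \prod_(j | j != i) v j t.
  rewrite (bigD1 i)//= eqxx; congr (_ * _).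
  by apply: eq_bigr => j /negbTE ->.
rewrite !E C01_addE C01_scaleE.
by rewrite mulrDl mulrDr -mulrA mulrCA.
Qed.

Let C01_prod_mbounded n c : mbounded (@C01_prod n c).
Proof. by exists `|c| => v; exact: C01_prod_norm. Qed.

Definition mulform n c : mlin (C01 R) (C01 R) n := mlin_of (@C01_prod n c).

Lemma mulformE n c v : mulform n c v = C01_prod c v.
Proof. by rewrite /mulform mlin_ofE. Qed.

Lemma mulform_norm n c : `|mulform n c| <= `|c|.
Proof.
apply: mlin_norm_le => v v1; rewrite mulformE.
rewrite (le_trans (C01_prod_norm _ _))// ler_piMr//.
by apply: prodr_ile1 => i _; rewrite normr_ge0 v1.
Qed.

Lemma mulform_linear n : linear (mulform n).
Proof.
move=> a c d; apply: mlin_eqP => v.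
rewrite mlin_addE mlin_scaleE !mulformE.
by apply: C01P => t /=; rewrite mulrDl mulrA.
Qed.

HB.instance Definition _ n :=
  GRing.isLinear.Build R (C01 R) (mlin (C01 R) (C01 R) n) _ (mulform n)
    (@mulform_linear n).

Lemma mulform_continuous n : continuous (mulform n).
Proof.
apply: bounded_linear_continuous; apply/linear_boundedP.
exists 1; split => // r r1 c.
by rewrite (le_trans (mulform_norm n c))// ler_peMl// ltW.
Qed.

(** Splitting off the first argument matches the recursion that defines [fderiv]. *)
Lemma mulformS n c (v : 'I_n.+1 -> C01 R) :
  mulform n.+1 c v = mulform n (C01_mul c (v ord0)) (fun i => v (lift ord0 i)).
Proof.
by rewrite !mulformE; apply: C01P => t /=; rewrite big_ord_recl mulrA.
Qed.

End C01_products.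

Arguments smooth_continuous {R f} n _ _.

(** * Superposition operators and their derivatives *)

Section nemytskii.
Variable R : realType.
Implicit Types (f : R -> R) (x y : C01 R).

Lemma nemytskii_subproof f (cf : continuous f) x : continuous (fun t => f (x t)).
Proof. by move=> t; apply: continuous_comp; [exact: C01_continuous | exact: cf]. Qed.

Definition nemytskii f (cf : continuous f) x : C01 R :=
  MkC01 (@nemytskii_subproof f cf x).

(** The Taylor bound has the same [M] at every [t], so the remainder is at most [M * |y|^2] in the
    maximum norm. *)
Lemma nemytskii_diff f (cf : continuous f) (cdf : continuous (derive1 f))
    (M : R) x : smooth f -> (forall s, `|derive1n 2 f s| <= M) ->
  differentiable (nemytskii cf) x /\
  'd (nemytskii cf) x = C01_mul (nemytskii cdf x) :> (C01 R -> C01 R).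
Proof.
move=> sf fM; set N := nemytskii cf; pose D := C01_mul (nemytskii cdf x).
have cD : continuous D by exact: C01_mul_continuous.
have M0 : 0 <= M by rewrite (le_trans _ (fM 0)).
have M1 : 0 < M + 1 by rewrite ltr_wpDl.
have ND : N \o shift x = cst (N x) + D +o_ 0 id.
  apply/eqaddoP => _/posnumP[e]; near=> y.
  apply: (@le_trans _ _ (M * `|y| ^+ 2)).
    apply: C01_norm_le => t.
    have := taylor1_le (x t) (y t) sf fM.
    rewrite /= opprD addrA [y t + _]addrC => /le_trans; apply.
    by rewrite ler_wpM2l// lerXn2r ?nnegrE//; exact: C01_norm_ge.
  rewrite expr2 mulrA ler_wpM2r//.
  (* [M + 1] is positive even when [M = 0], so [y] may be taken with norm below [e / (M + 1)]. *)
  apply: (@le_trans _ _ ((M + 1) * `|y|)); first by rewrite ler_wpM2r// lerDl.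
  rewrite -ler_pdivlMl// mulrC ltW//.
  by near: y; apply: nbhs0_lt; exact: divr_gt0.
have dN := diff_unique cD ND.
by split=> //; apply/diff_locallyP; rewrite dN.
Unshelve. all: by end_near. Qed.

Section fderiv_nemytskii.
Variable f : R -> R.
Hypothesis sf : smooth f.
Hypothesis bf : forall m, exists M : R, forall s, `|derive1n m f s| <= M.

Let N n := nemytskii (smooth_continuous n sf).

Let N_diff n x : differentiable (N n) x /\
  'd (N n) x = C01_mul (N n.+1 x) :> (C01 R -> C01 R).
Proof.
have [M fM] := bf n.+2; apply: (@nemytskii_diff _ _ _ M) => //.
(* Smoothness of the [n]-th derivative: its derivatives are those of [f] of order [m + n]. *)
by move=> m s; rewrite /derive1n -iterD; exact: sf.
Qed.

(** By the chain rule, the continuous linear map [mulform n] being its own derivative, the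
    derivative of the right side in direction [v ord0] is [mulform n (C01_mul (N n.+1 x) (v ord0))];
    [mulformS] concludes. *)
Lemma fderiv_nemytskii n : fderiv (N 0) n = @mulform R n \o N n.
Proof.
elim: n => [|n IHn]; apply/funext => x; apply: mlin_eqP => v.
  rewrite fderiv0E mulformE; apply: C01P => t /=.
  by rewrite big_ord0 mulr1.
have [dN dNE] := N_diff n x.
have dM := linear_differentiable (N n x) (@mulform_continuous R n).
rewrite fderivSE IHn; last exact: differentiable_comp.
by rewrite diff_comp// diff_lin/= ?dNE ?mulformS//; exact: mulform_continuous.
Qed.

Lemma differentiable_fderiv_nemytskii n x : differentiable (fderiv (N 0) n) x.
Proof.
rewrite fderiv_nemytskii; apply: differentiable_comp; first by have [] := N_diff n x.
exact/linear_differentiable/mulform_continuous.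
Qed.

Lemma fderiv_nemytskii_bounded n (M : R) x :
  (forall s, `|derive1n n f s| <= M) -> `|fderiv (N 0) n x| <= M.
Proof.
move=> fM; rewrite fderiv_nemytskii (le_trans (mulform_norm _ _))//.
by apply: C01_norm_le => t; exact: fM.
Qed.

Lemma nemytskii_class_C : class_C None (N 0).
Proof.
split=> [j _|j _ x]; first exact: differentiable_fderiv_nemytskii.
exact/differentiable_continuous/differentiable_fderiv_nemytskii.
Qed.

End fderiv_nemytskii.
End nemytskii.

Theorem mainTheorem3 (R : realType) (h : R -> R) (hbump : smooth_bump h) :
  exists H : C01 R -> C01 R,
    [/\ forall (x : C01 R) (t : I01 R), H x t = h (x t) * x t,
        blid_map None H &
        forall j : nat, (1 <= j)%N ->
          (ereal_sup (range (fun x : C01 R => `|fderiv H j x|%:E)) < +oo)%E].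
Proof.
have [sh bh h1] := hbump; pose g s := h s * s.
have sg : smooth g by exact: smooth_mulid.
have bg n : exists M : R, forall s, `|derive1n n g s| <= M.
  apply: smooth_derive1n_bounded => //.
  (* The support of [g] lies in that of [h], so the same bound serves. *)
  case: bh => K [Kr hK]; exists K; split => // r /hK hr s gs; apply: hr.
  apply: closure_subset gs => u /=.
  by apply: contra_neq; rewrite /g => ->; rewrite mul0r.
have sup_lt (T : Type) (u : T -> R) (M : R) : (forall x, u x <= M) ->
    (ereal_sup (range (fun x => (u x)%:E)) < +oo)%E.
  move=> uM; apply: (@le_lt_trans _ _ M%:E); last exact: ltry.
  by apply: ge_ereal_sup => _ [x _ <-]; rewrite lee_fin.
exists (nemytskii (smooth_continuous 0 sg)); split => //; last first.
  move=> j _; have [M gM] := bg j; apply: (sup_lt _ _ M) => x.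
  exact: fderiv_nemytskii_bounded.
split; first exact: nemytskii_class_C.
- have [e /= e0 he] := h1; near=> x; apply: C01P => t /=.
  (* If [|x| < e], every value [x t] lies in the neighborhood of 0 where [h] is 1. *)
  rewrite /g he ?mul1r//= sub0r normrN (le_lt_trans (C01_norm_ge x t))//.
  by near: x; exact: nbhs0_lt.
- have [M gM] := bg 0%N; apply: (sup_lt _ _ M) => x.
  by apply: C01_norm_le => t; exact: gM.
Unshelve. all: by end_near. Qed.
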